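(* Fix a finite state space $X$, a finite action space $U$ with projection $s:U\to X$, a transition function $f$ and a discount factor $\gamma\in[0,1)$, and consider the class of all MDPs $\mathfrak{M}(r,\gamma f)$ as $r$ ranges over $\mathrm{Map}(U,\mathbb{R})$. Then: (a) In every $\ell$-orbit of $\mathrm{Map}(U,\mathbb{R})$ there exists a unique reward function whose MDP is in normal form. (b) The MDP $\mathfrak{M}(r,\gamma f)$ is in normal form if and only if $$\max_{u\in U_x} r(u)=0\quad\text{for all }x\in X.$$
   Context: $X$ is a finite set of states, $U$ is a finite set of actions with a projection $s:U\to X$ such that each fiber $U_x:=s^{-1}(x)$ (the actions available in state $x$) is nonempty. $f:X\times U\to[0,1]$ is a transition function, $\sum_{z\in X}f(z,u)=1$ for all $u$ ($f(z,u)$ is the probability of moving to $z$ after applying $u$); $\gamma\in[0,1)$ is the discount factor; $r:U\to\mathbb{R}$ is a reward function. $\mathfrak{M}(r,\gamma f)$ denotes the MDP with these data. A (deterministic stationary) policy is a map $\pi:X\to U$ with $s\circ\pi=\mathrm{id}_X$. Its value function $v_{\pi,r}:X\to\mathbb{R}$ is the expected discounted return, i.e. the unique solution of $v(x)=r(\pi(x))+\gamma\sum_{z\in X}f(z,\pi(x))v(z)$ for all $x\in X$. A policy $\pi^*$ is optimal if $v_{\pi^*,r}\ge v_{\pi,r}$ pointwise for all policies $\pi$ (one always exists); $v_{\pi^*,r}$ is the optimal value function. An MDP is in normal form if its optimal value function is identically zero. For $\delta\in\mathrm{Map}(X,\mathbb{R})$ define $\ell_\delta(r):=r+b(\delta)$,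 where $b(\delta)(u):=\gamma\sum_{z\in X}f(z,u)\delta(z)-\delta(s(u))$. This is an action of the additive group $\mathrm{Map}(X,\mathbb{R})$ on $\mathrm{Map}(U,\mathbb{R})$; its orbits are called $\ell$-orbits. *)

(* Defs.v *)
From HB Require Import structures.
From mathcomp Require Import all_boot all_order all_algebra.
From mathcomp Require Import all_classical all_reals.

Set Implicit Arguments.
Unset Strict Implicit.
Unset Printing Implicit Defensive.

Import Order.TTheory GRing.Theory Num.Theory.
Local Open Scope classical_set_scope.
Local Open Scope ring_scope.

(* [f z u] is the probability of moving to state [z] after applying the action
   [u]; [s u] is the state in which [u] is available. *)
Definition transition_function (R : realType) (X U : finType)
    (f : X -> U -> R) : Prop :=
  (forall z u, 0 <= f z u <= 1) /\ (forall u, \sum_(z : X) f z u = 1).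

Definition policy (X U : finType) (s : U -> X) (pi : X -> U) : Prop :=
  forall x, s (pi x) = x.

Definition policy_equation (R : realType) (X U : finType) (f : X -> U -> R)
    (gamma : R) (r : U -> R) (pi : X -> U) (v : X -> R) : Prop :=
  forall x, v x = r (pi x) + gamma * \sum_(z : X) f z (pi x) * v z.

(* The solution of [policy_equation]; the default 0 of [xget] is never used, and
   the solution is unique, by [valueP] and [value_unique] below. *)
Definition value (R : realType) (X U : finType) (f : X -> U -> R)
    (gamma : R) (r : U -> R) (pi : X -> U) : X -> R :=
  xget (fun=> 0) [set v | policy_equation f gamma r pi v].

Definition optimal_policy (R : realType) (X U : finType) (s : U -> X)
    (f : X -> U -> R) (gamma : R) (r : U -> R) (pi : X -> U) : Prop :=
  policy s pi /\
  forall pi', policy s pi' ->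
    forall x, value f gamma r pi' x <= value f gamma r pi x.

(* All optimal policies have the same value function, so at most one [v]
   satisfies this. *)
Definition is_optimal_value (R : realType) (X U : finType) (s : U -> X)
    (f : X -> U -> R) (gamma : R) (r : U -> R) (v : X -> R) : Prop :=
  exists2 pi, optimal_policy s f gamma r pi & v = value f gamma r pi.

Definition normal_form (R : realType) (X U : finType) (s : U -> X)
    (f : X -> U -> R) (gamma : R) (r : U -> R) : Prop :=
  is_optimal_value s f gamma r (fun=> 0).

Definition ell_shift (R : realType) (X U : finType) (s : U -> X)
    (f : X -> U -> R) (gamma : R) (delta : X -> R) : U -> R :=
  fun u => gamma * (\sum_(z : X) f z u * delta z) - delta (s u).

Definition ell (R : realType) (X U : finType) (s : U -> X)
    (f : X -> U -> R) (gamma : R) (delta : X -> R) (r : U -> R) : U -> R :=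
  fun u => r u + ell_shift s f gamma delta u.

Definition ell_orbit (R : realType) (X U : finType) (s : U -> X)
    (f : X -> U -> R) (gamma : R) (r : U -> R) : set (U -> R) :=
  [set ell s f gamma delta r | delta in [set: X -> R]].

(* The maximum of [r] over the actions available in [x]. Extended reals are used
   only to have -oo as the maximum of an empty family, so that no default value
   is involved when [x] has an action. *)
Definition max_reward (R : realType) (X U : finType) (s : U -> X)
    (r : U -> R) (x : X) : \bar R :=
  \big[Order.max/-oo%E]_(u : U | s u == x) (r u)%:E.

Section ValueFunction.
Variables (R : realType) (X U : finType) (f : X -> U -> R) (gamma : R).
Hypotheses (hf : transition_function f) (hgamma : 0 <= gamma < 1).
Implicit Types (r : U -> R) (pi : X -> U) (v w : X -> R).

Lemma policy_equation0 pi w :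
  policy_equation f gamma (fun=> 0) pi w -> forall x, w x = 0.
Proof.
move=> hw x0.
case: (@arg_maxP _ _ _ x0 predT (fun x => `|w x|) isT) => x _ hx.
have [f01 f1] := hf; have /andP[g0 g1] := hgamma.
have le_wx : `|w x| <= gamma * `|w x|.
  rewrite {1}hw add0r normrM (ger0_norm g0) ler_wpM2l //.
  rewrite (le_trans (ler_norm_sum _ _ _)) //.
  rewrite -[leRHS]mul1r -(f1 (pi x)) mulr_suml ler_sum // => z _.
  have /andP[f0 _] := f01 z (pi x).
  by rewrite normrM (ger0_norm f0) ler_wpM2l //; apply: hx.
have wx0 : `|w x| <= 0.
  rewrite -(@pmulr_rle0 _ (1 - gamma)) ?subr_gt0 //.
  by rewrite mulrBl mul1r subr_le0.
by apply/eqP; rewrite -normr_le0 (le_trans _ wx0) //; apply: hx.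
Qed.

Lemma policy_equation_unique r pi v w :
  policy_equation f gamma r pi v -> policy_equation f gamma r pi w -> v = w.
Proof.
move=> hv hw; apply/funext => x; apply/eqP; rewrite -subr_eq0; apply/eqP.
apply: (@policy_equation0 pi (fun x => v x - w x)) => {}x.
rewrite /= add0r (hv x) (hw x) opprD addrACA subrr add0r -mulrBr -sumrB; congr (_ * _).
by apply: eq_bigr => z _; rewrite mulrBr.
Qed.

Lemma policy_equation_exists r pi : exists v, policy_equation f gamma r pi v.
Proof.
pose A : 'M[R]_#|X| := \matrix_(j, i)
  ((i == j)%:R - gamma * f (enum_val j) (pi (enum_val i))).
have mulA (u : 'rV[R]_#|X|) i : (u *m A) 0 i =
    u 0 i - gamma * \sum_(z : X) f z (pi (enum_val i)) * u 0 (enum_rank z).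
  rewrite mxE; under eq_bigr do rewrite mxE mulrBr.
  rewrite sumrB (bigD1 i) //= eqxx mulr1 big1 ?addr0; last first.
    by move=> j /negPf ji; rewrite eq_sym ji mulr0.
  rewrite (reindex_onto (@enum_rank X) enum_val) /=; last first.
    by move=> j _; rewrite enum_valK.
  rewrite mulr_sumr; congr (_ - _); apply: eq_big => [z|z _].
    by rewrite enum_rankK eqxx.
  by rewrite enum_rankK mulrC mulrA.
have freeA : row_free A.
  rewrite -kermx_eq0; apply/eqP/row_matrixP => k.
  have := sub_kermxP (row_sub k (kermx A)).
  move: (row k _) => u uA; apply/rowP => i; rewrite row0 mxE.
  have := @policy_equation0 pi (fun x => u 0 (enum_rank x)).
  move=> /(_ _ (enum_val i)); rewrite enum_valK; apply => x.
  have /eqP := mulA u (enum_rank x).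
  by rewrite uA mxE enum_rankK eq_sym subr_eq0 add0r => /eqP.
have unitA : A \in unitmx by rewrite -row_free_unit.
pose u := (\row_i r (pi (enum_val i))) *m invmx A.
exists (fun x => u 0 (enum_rank x)) => x.
have /eqP := mulA u (enum_rank x).
by rewrite mulmxKV // mxE !enum_rankK eq_sym subr_eq => /eqP.
Qed.

Lemma valueP r pi : policy_equation f gamma r pi (value f gamma r pi).
Proof.
have [v hv] := policy_equation_exists r pi.
exact: (xgetPex (fun=> 0) (ex_intro _ v hv)).
Qed.

Lemma value_unique r pi v :
  policy_equation f gamma r pi v -> v = value f gamma r pi.
Proof. by move=> hv; apply: policy_equation_unique hv (valueP r pi). Qed.

End ValueFunction.

(* Main.v *)
(* By the maximum principle for gamma * f, a function v with ell v r <= 0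
   dominates every value function, and the value function of a policy pi is
   characterised by ell v r = 0 along pi.  A policy whose values have the largest
   sum cannot be improved at any single action, so its value function v has
   ell v r <= 0.  Hence v is the optimal value of r iff ell v r is nonpositive and
   vanishes along some policy, that is, iff ell v r is in normal form. *)

Require Import Defs.
From HB Require Import structures.
From mathcomp Require Import all_boot all_order all_algebra.
From mathcomp Require Import all_classical all_reals.
From mathcomp Require Import ring.

Set Implicit Arguments.
Unset Strict Implicit.
Unset Printing Implicit Defensive.

Import Order.TTheory GRing.Theory Num.Theory.
Local Open Scope classical_set_scope.
Local Open Scope ring_scope.

Section OptimalValue.
Variables (R : realType) (X U : finType) (s : U -> X) (f : X -> U -> R).
Variable gamma : R.
Hypotheses (hf : transition_function f) (hgamma : 0 <= gamma < 1).
Implicit Types (r : U -> R) (pi : X -> U) (v w : X -> R).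

(** Maximum principle: where [w] is largest, its average under [f] is at most [w x], so
    [(1 - gamma) * w x <= 0]. *)
Lemma subharmonic_le0 pi w :
  (forall x, w x <= gamma * \sum_(z : X) f z (pi x) * w z) ->
  forall x, w x <= 0.
Proof.
move=> hw x0.
case: (@arg_maxP _ _ _ x0 predT w isT) => x _ hx.
have [f01 f1] := hf; have /andP[g0 g1] := hgamma.
apply: le_trans (hx x0 isT) _.
rewrite -(@pmulr_rle0 _ (1 - gamma)) ?subr_gt0 //.
rewrite mulrBl mul1r subr_le0 (le_trans (hw x)) // ler_wpM2l //.
rewrite -[leRHS]mul1r -(f1 (pi x)) mulr_suml ler_sum // => z _.
by have /andP[f0 _] := f01 z (pi x); rewrite ler_wpM2l //; apply: hx.
Qed.

Lemma ell_policy r pi v x : policy s pi ->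
  ell s f gamma v r (pi x)
  = r (pi x) + gamma * (\sum_(z : X) f z (pi x) * v z) - v x.
Proof. by move=> spi; rewrite /ell /ell_shift spi addrA. Qed.

Lemma policy_equationE r pi v : policy s pi ->
  policy_equation f gamma r pi v <-> forall x, ell s f gamma v r (pi x) = 0.
Proof.
move=> spi; split=> hv x; first by rewrite ell_policy // -hv subrr.
by have /eqP := hv x; rewrite ell_policy // subr_eq0 eq_sym => /eqP.
Qed.

Lemma ell_value r pi x : policy s pi ->
  ell s f gamma (value f gamma r pi) r (pi x) = 0.
Proof.
by move=> spi; move: x; apply/policy_equationE => //; apply: valueP hf hgamma _ _.
Qed.

Lemma ell_subE r v w u :
  ell s f gamma v r u - ell s f gamma w r u
  = gamma * (\sum_(z : X) f z u * (v z - w z)) - (v (s u) - w (s u)).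
Proof.
have -> : \sum_z f z u * (v z - w z) = \sum_z f z u * v z - \sum_z f z u * w z.
  by rewrite -sumrB; apply: eq_bigr => z _; rewrite mulrBr.
by rewrite /ell /ell_shift; ring.
Qed.

(** By [ell_subE] the hypothesis makes [v - w] subharmonic along [pi]; the reward cancels. *)
Lemma ell_comparison r pi v w : policy s pi ->
  (forall x, ell s f gamma w r (pi x) <= ell s f gamma v r (pi x)) ->
  forall x, v x <= w x.
Proof.
move=> spi h x; rewrite -subr_le0; move: x.
apply: (@subharmonic_le0 pi (fun x => v x - w x)) => x.
by rewrite -subr_ge0 -{2 3}(spi x) -(ell_subE r) subr_ge0.
Qed.

Lemma value_le r pi v : policy s pi ->
  (forall x, ell s f gamma v r (pi x) <= 0) ->
  forall x, value f gamma r pi x <= v x.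
Proof.
by move=> spi h; apply: (ell_comparison (r := r) spi) => x; rewrite ell_value.
Qed.

Lemma value_ge r pi v : policy s pi ->
  (forall x, 0 <= ell s f gamma v r (pi x)) ->
  forall x, v x <= value f gamma r pi x.
Proof.
by move=> spi h; apply: (ell_comparison (r := r) spi) => x; rewrite ell_value.
Qed.

Lemma optimal_value_exists r (hs : forall x, exists u, s u = x) :
  exists2 pi, policy s pi &
    forall u, ell s f gamma (value f gamma r pi) r u <= 0.
Proof.
have [p0 p0P] := choice hs.
(* The pointwise order on values is only partial; summing over states gives a real objective, which
   has a maximiser among the finitely many policies. *)
pose total (p : {ffun X -> U}) := \sum_x value f gamma r p x.
pose isP (p : {ffun X -> U}) := [forall x, s (p x) == x].
have p0F : isP (finfun p0) by apply/forallP => x; rewrite ffunE p0P.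
case: (@arg_maxP _ _ _ (finfun p0) isP total p0F) => p /forallP pP pmax.
have sp : policy s p by move=> x; apply/eqP.
exists p => // u; rewrite leNgt; apply/negP => u_gt0.
set v := value f gamma r p in u_gt0.
(* Policy improvement: switch [p] to [u] in the single state [s u]. *)
pose q := [ffun x => if x == s u then u else p x].
have sq : policy s q by move=> x; rewrite ffunE; case: eqP.
have le_vq : forall x, v x <= value f gamma r q x.
  apply: value_ge => // x; rewrite ffunE; case: eqP => _; first exact: ltW.
  by rewrite ell_value.
(* The gains of [q] over [p] are nonnegative, and by maximality of [p] their sum is at most 0, so
   each one vanishes. *)
have eq_vq x : v x = value f gamma r q x.
  have le_q : total q <= total p.
    by apply: pmax; apply/forallP => y; apply/eqP.
  have eq_sum : \sum_x (value f gamma r q x - v x) == 0.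
    rewrite eq_le sumr_ge0 ?andbT => [|y _]; last by rewrite subr_ge0.
    by rewrite sumrB subr_le0.
  move: eq_sum; rewrite psumr_eq0 => [|y _]; last by rewrite subr_ge0.
  by move=> /allP/(_ x (mem_index_enum x)); rewrite subr_eq0 => /eqP.
(* As [v] is also the value of [q], the shifted reward vanishes at [q (s u) = u], against
   [u_gt0]. *)
have := ell_value r (s u) sq; rewrite -(funext eq_vq) ffunE eqxx => u0.
by rewrite u0 ltxx in u_gt0.
Qed.

Lemma is_optimal_value_unique r v w :
  is_optimal_value s f gamma r v -> is_optimal_value s f gamma r w -> v = w.
Proof.
move=> [p [sp hp] ->] [q [sq hq] ->]; apply/funext => x.
by apply/eqP; rewrite eq_le hq // hp.
Qed.

(** Bellman's optimality equation, with the maximum over actions split into an upper bound and its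
    attainment by a policy. *)
Lemma is_optimal_valueP r v (hs : forall x, exists u, s u = x) :
  is_optimal_value s f gamma r v <->
  (forall u, ell s f gamma v r u <= 0) /\
  exists2 pi, policy s pi & forall x, ell s f gamma v r (pi x) = 0.
Proof.
have bellman p w : policy s p -> w = value f gamma r p ->
    (forall u, ell s f gamma w r u <= 0) -> is_optimal_value s f gamma r w.
  move=> sp ew le0; exists p => //; split=> // q sq x.
  by rewrite -ew; apply: value_le.
split=> [ov|[le0 [p sp eq0]]]; last first.
  apply: (bellman p) => //; apply: (value_unique hf hgamma).
  exact/policy_equationE.
have [p sp le0] := optimal_value_exists r hs.
have -> := is_optimal_value_unique ov (bellman p _ sp erefl le0).
by split=> //; exists p => // x; apply: ell_value.
Qed.


Lemma ell0 r : ell s f gamma (fun=> 0) r = r.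
Proof.
apply/funext => u; rewrite /ell /ell_shift big1 ?mulr0 ?subr0 ?addr0 //.
by move=> z _; rewrite mulr0.
Qed.

(** Both sides unfold to the same Bellman condition, since shifting by 0 changes nothing. *)
Lemma normal_form_ell r v (hs : forall x, exists u, s u = x) :
  normal_form s f gamma (ell s f gamma v r) <-> is_optimal_value s f gamma r v.
Proof.
by rewrite /normal_form !is_optimal_valueP // ell0.
Qed.

End OptimalValue.

Lemma max_reward_eq0 (R : realType) (X U : finType) (s : U -> X) (r : U -> R) x :
  max_reward s r x = 0%E <->
  (forall u, s u = x -> r u <= 0) /\ exists2 u, s u = x & r u = 0.
Proof.
split=> [max0|[le0 [u su ru]]].
  split=> [u su|].
    rewrite -(lee_fin (r u) 0) -[leRHS]max0.
    by apply: (le_bigmax_cond _ (fun u => (r u)%:E)); apply/eqP.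
  (* A state without actions would have maximum -oo rather than 0. *)
  case: (pickP (fun u => s u == x)) => [u0 su0|no]; last first.
    by move: max0; rewrite /max_reward big_pred0.
  have [u su eu] := eq_bigmax u0 (fun u => s u == x) (fun u => (r u)%:E) su0
    (fun u _ => leNye _).
  exists u; first exact/eqP.
  by move: max0; rewrite /max_reward eu => -[].
apply/eqP; rewrite eq_le; apply/andP; split.
  by apply: bigmax_le => [|v /eqP sv]; rewrite ?leNye ?lee_fin ?le0.
have <- : (r u)%:E = 0%E by rewrite ru.
by apply: (le_bigmax_cond _ (fun u => (r u)%:E)); apply/eqP.
Qed.

Theorem theorem10 (R : realType) (X U : finType) (s : U -> X)
    (hs : forall x : X, exists u : U, s u = x)
    (f : X -> U -> R) (hf : transition_function f)
    (gamma : R) (hgamma : 0 <= gamma < 1) :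
  (forall r0 : U -> R,
     exists! r : U -> R, ell_orbit s f gamma r0 r /\ normal_form s f gamma r) /\
  (forall r : U -> R,
     normal_form s f gamma r <-> forall x : X, max_reward s r x = 0%E).
Proof.
split=> [r0|r].
  have [p sp le0] := optimal_value_exists hf hgamma r0 hs.
  pose v := value f gamma r0 p.
  have ov : is_optimal_value s f gamma r0 v.
    by apply/is_optimal_valueP => //; split=> //; exists p => // x; apply: ell_value.
  exists (ell s f gamma v r0); split.
    by split; [exists v|apply/normal_form_ell].
  (* Any shift [w] reaching normal form is itself the optimal value of [r0], hence equals [v]. *)
  move=> _ [[w _ <-] /normal_form_ell ow].
  by rewrite (is_optimal_value_unique ov (ow hf hgamma hs)).
rewrite /normal_form is_optimal_valueP // ell0; split.
  move=> [le0 [p sp r0]] x; apply/max_reward_eq0; split=> [u _|]; first exact: le0.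
  by exists (p x).
move=> max0; split=> [u|].
  by have /max_reward_eq0[le0 _] := max0 (s u); apply: le0.
(* Choosing in each state an action of reward 0 assembles the required policy. *)
have /choice[p pP] x : exists u, s u = x /\ r u = 0.
  by have /max_reward_eq0[_ [u su ru]] := max0 x; exists u.
by exists p => x; have [] := pP x.
Qed.
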